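(* Let $\mu$ be a balanced measure on $\mathbb{R}$ and let $N\ge0$ be an integer. There exist $\eta\in(0,1)$ and $C>0$, depending only on $\mu$ and $N$, such that for each pair of compactly supported, bounded, nonnegative functions $f_1,f_2\in L^1(\mu)$ there exists an $\eta$-sparse collection $\mathcal{S}\subset\mathscr{D}$ such that $$|\langle\mathcal{M}^Nf_1,f_2\rangle|\le C\big(\mathcal{A}_{\mathcal{S}}(f_1,f_2)+\mathcal{C}^N_{\mathcal{S}}(f_1,f_2)\big).$$
   Context: $\mathscr{D}$ is the standard dyadic system of half-open intervals $2^{-k}[j,j+1)$, $j,k\in\mathbb{Z}$. For $I\in\mathscr{D}$, $I_-$ and $I_+$ are its left and right dyadic children, $\widehat{I}$ its dyadic parent, and $I^{(j)}$ its $j$-th dyadic ancestor ($I^{(0)}=I$). The dyadic distance is $\operatorname{dist}_{\mathscr{D}}(I,J)=\min\{s+t:\ s,t\ge0,\ I^{(s)}=J^{(t)}\}$, and $=\infty$ if $I,J$ have no common dyadic ancestor. $\mu$ is a Borel measure on $\mathbb{R}$ with $0<\mu(I)<\infty$ for all $I\in\mathscr{D}$. Pairings and averages are with respect to $\mu$: $\langle f,g\rangle=\int fg\,d\mu$, $\langle f\rangle_I=\mu(I)^{-1}\int_I f\,d\mu$. Set $m(I)=\mu(I_-)\mu(I_+)/\mu(I)$. The measure $\mu$ is balanced if it has no atoms and there is $c\ge1$ with $c^{-1}m(\widehat{I})\le m(I)\le c\,m(\widehat{I})$ for all $I\in\mathscr{D}$. The maximal operator is $\mathcal{M}^Nf(x)=\sup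 c_1^b(I,J)\langle|f|\rangle_I1_J(x)$, the supremum being over $I,J\in\mathscr{D}$ with $\operatorname{dist}_{\mathscr{D}}(I,J)\le N+2$, where $c_1^b(I,J)=1$ if $I=J$ and $c_1^b(I,J)=\frac{\sqrt{m(I)m(J)}}{\mu(J)}$ otherwise. A collection $\mathcal{S}\subset\mathscr{D}$ is $\eta$-sparse if for each $I\in\mathcal{S}$ there is a measurable $E_I\subset I$ with $\mu(E_I)\ge\eta\mu(I)$ and the sets $\{E_I\}_{I\in\mathcal{S}}$ are pairwise disjoint. The forms are $$\mathcal{A}_{\mathcal{S}}(f_1,f_2)=\sum_{I\in\mathcal{S}}\langle f_1\rangle_I\langle f_2\rangle_I\mu(I),\qquad \mathcal{C}^N_{\mathcal{S}}(f_1,f_2)=\sum_{\substack{J,K\in\mathcal{S}:\ J\cap K=\emptyset\\ 2<\operatorname{dist}_{\mathscr{D}}(J,K)\le N+2}}\langle f_1\rangle_J\langle f_2\rangle_K\sqrt{m(J)}\sqrt{m(K)}.$$ *)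

(* Defs.v *)
From HB Require Import structures.
From mathcomp Require Import all_boot all_order all_algebra.
From mathcomp Require Import all_classical all_reals all_analysis.

Set Implicit Arguments.
Unset Strict Implicit.
Unset Printing Implicit Defensive.

Import Order.TTheory GRing.Theory Num.Theory.
Import numFieldNormedType.Exports.

Local Open Scope classical_set_scope.
Local Open Scope ring_scope.

(* The index (k, j) stands for the interval 2^-k [j, j + 1).  Distinct indices
   give distinct intervals, so a collection of dyadic intervals is a set of
   indices.  Large k means a short interval. *)
Definition dyadic : choiceType := (int * int)%type.

Definition ditv (R : realType) (I : dyadic) : set R :=
  [set` `[(2 : R) ^ (- I.1) * I.2%:~R, (2 : R) ^ (- I.1) * (I.2 + 1)%:~R[ ].

Arguments ditv : clear implicits.

Definition lchild (I : dyadic) : dyadic := (I.1 + 1, 2 * I.2).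
Definition rchild (I : dyadic) : dyadic := (I.1 + 1, 2 * I.2 + 1).
(* [%/] on int rounds down for a positive divisor, also when I.2 < 0 *)
Definition parent (I : dyadic) : dyadic := (I.1 - 1, (I.2 %/ 2)%Z).
Definition ancestor (s : nat) (I : dyadic) : dyadic := iter s parent I.

(* The infimum is a minimum when I and J have a common ancestor, and is +oo
   (infimum of the empty set) otherwise. *)
Definition ddist (R : realType) (I J : dyadic) : \bar R :=
  ereal_inf [set ((st.1 + st.2)%N%:R)%:E | st in
             [set st : nat * nat | ancestor st.1 I = ancestor st.2 J]].

Arguments ddist : clear implicits.

Section dyadic_measure.
Context (R : realType) (mu : {measure set (measurableTypeR R) -> \bar R}).

Definition mass (I : dyadic) : R := fine (mu (ditv R I)).

Definition mD (I : dyadic) : R :=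
  mass (lchild I) * mass (rchild I) / mass I.

Definition balanced : Prop :=
  (forall x : R, mu [set x] = 0%E) /\
  exists c : R, 1 <= c /\
    forall I : dyadic, c^-1 * mD (parent I) <= mD I <= c * mD (parent I).

Definition avg (f : R -> R) (I : dyadic) : \bar R :=
  ((mass I)^-1%:E * \int[mu]_(x in ditv R I) (f x)%:E)%E.

Definition pairing (f g : R -> \bar R) : \bar R :=
  (\int[mu]_x (f x * g x))%E.

Definition c1b (I J : dyadic) : R :=
  if I == J then 1 else Num.sqrt (mD I * mD J) / mass J.

Definition maximalN (N : nat) (f : R -> R) (x : R) : \bar R :=
  ereal_sup [set ((c1b IJ.1 IJ.2)%:E * avg (fun y => `|f y|%R) IJ.1
                  * (\1_(ditv R IJ.2) x)%:E)%E | IJ in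
             [set IJ : dyadic * dyadic |
              (ddist R IJ.1 IJ.2 <= ((N + 2)%N%:R)%:E)%E]].

Definition sparse_family (eta : R) (S : set dyadic) : Prop :=
  exists E : dyadic -> set (measurableTypeR R),
    [/\ forall I, S I -> measurable (E I),
        forall I, S I -> E I `<=` ditv R I,
        forall I, S I -> (eta%:E * mu (ditv R I) <= mu (E I))%E
      & trivIset S E].

(* [\esum] is the unordered sum of nonnegative terms: these two forms are
   meaningful for nonnegative f1 and f2. *)
Definition A_form (S : set dyadic) (f1 f2 : R -> R) : \bar R :=
  (\esum_(I in S) (avg f1 I * avg f2 I * mu (ditv R I)))%E.

Definition C_form (N : nat) (S : set dyadic) (f1 f2 : R -> R) : \bar R :=
  (\esum_(JK in [set JK : dyadic * dyadic |
       [/\ S JK.1, S JK.2, ditv R JK.1 `&` ditv R JK.2 = set0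
         & (2%:E < ddist R JK.1 JK.2 <= ((N + 2)%N%:R)%:E)%E]])
     (avg f1 JK.1 * avg f2 JK.2
      * (Num.sqrt (mD JK.1))%:E * (Num.sqrt (mD JK.2))%:E))%E.

(* f is a pointwise representative of its class in L^1(mu). *)
Definition test_fun (f : R -> R) : Prop :=
  [/\ mu.-integrable setT (EFin \o f),
      compact (closure [set x | f x != 0]),
      bounded_fun f
    & forall x, 0 <= f x].

End dyadic_measure.

(* Main.v *)
(* The sparse family S is built from f1 alone, by stopping at a dyadic interval
   J' below its stopping ancestor J when either the mean of f1 or the whole local
   supremum sup_I c(I,J)<f1>_I, over I with dist(I,J) <= N + 2, jumps by a large
   factor A.

   Packing: if the supremum jumps at J' because of some I', either I' lies in J,
   and then it sits in a maximal interval Q of J with a large mean; J' is inside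
   Q or is one of boundedly many neighbours of Q, and mu(J') <= kappa int_Q f1
   with sum_Q kappa int_Q f1 <= mu(J)/(4D).  Or I' is not contained in J; then J'
   is one of boundedly many descendants of J and c(I',J') mu(J') is comparable to
   c(I',J) mu(J), so that mu(J') is a small fraction of mu(J).

   Domination: replace J, then I, by their stopping ancestors.  When the
   resulting pair is nested, or is a pair of siblings, balance bounds the term by
   the mean of f1 over an interval containing J; otherwise it is a term of
   C_form. *)

Require Import Defs.
From mathcomp Require Import all_boot all_order all_algebra.
From mathcomp Require Import all_classical all_reals all_analysis.
From mathcomp Require Import measurable_realfun.
From mathcomp Require Import zify ring lra.
Set Implicit Arguments.
Unset Strict Implicit.
Unset Printing Implicit Defensive.

Import Order.TTheory GRing.Theory Num.Theory.
Import numFieldNormedType.Exports.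

Local Open Scope classical_set_scope.
Local Open Scope ring_scope.

(** * Ancestry of dyadic intervals *)

Lemma in_ditv (R : realType) (I : dyadic) (x : R) :
  ditv R I x <-> Num.floor (2 ^ I.1 * x) = I.2.
Proof.
have p0 : 0 < (2 : R) ^ I.1 by rewrite exprz_gt0.
have -> : ditv R I x = (Num.floor (2 ^ I.1 * x) == I.2) :> Prop.
  rewrite floor_eq /ditv /= in_itv /= -invr_expz; congr (is_true (_ && _)).
  - by rewrite [in LHS]mulrC ler_pdivrMr // mulrC.
  - by rewrite [in LHS]mulrC ltr_pdivlMr // mulrC.
by split => [/eqP|->].
Qed.

(** Since membership in a dyadic interval is an equation between an index and a floor, this identity
    is what places an interval inside its [parent]. *)
Lemma floor_half (R : realType) (y : R) :
  Num.floor (y / 2) = (Num.floor y %/ 2)%Z.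
Proof.
apply: floor_def; have /andP[a b] := floor_itv y.
have e := divz_eq (Num.floor y) 2.
have := ltz_pmod (Num.floor y) (isT : (0 : int) < 2).
have := modz_ge0 (Num.floor y) (isT : (2 : int) != 0).
move: a b; rewrite {1 2}e; move: (_ %/ _)%Z (_ %% _)%Z => q r.
move=> a b r0 r2.
have {}r0 : (0 : R) <= r%:~R by rewrite ler0z.
have {}r2 : r%:~R <= (1 : R) by rewrite -[1]/(1%:~R) ler_int; lia.
move: a b; rewrite !rmorphD /= !rmorphM /= rmorph1 => a b.
rewrite ler_pdivlMr // ltr_pdivrMr //.
have e2 : (2 : int)%:~R = 2 :> R by [].
by rewrite e2 in a b; apply/andP; split; lra.
Qed.

Lemma ditv_parent (R : realType) (I : dyadic) : ditv R I `<=` ditv R (parent I).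
Proof.
move=> x /in_ditv e; apply/in_ditv => /=.
rewrite expfzDr ?pnatr_eq0 // mulrAC -e -floor_half; congr (Num.floor (_ / _)).
Qed.

Lemma ancestorS s I : ancestor s.+1 I = parent (ancestor s I).
Proof. by []. Qed.

Lemma ancestorD s t I : ancestor (s + t) I = ancestor s (ancestor t I).
Proof. exact: iterD. Qed.

Definition level (I : dyadic) : int := I.1.

Lemma ancestor_level s I : level (ancestor s I) = level I - s%:Z.
Proof.
elim: s => [|s IH]; first by rewrite subr0.
have -> : level (ancestor s.+1 I) = level (ancestor s I) - 1 by [].
by rewrite IH; lia.
Qed.

Lemma ditv_ancestor (R : realType) s (I : dyadic) :
  ditv R I `<=` ditv R (ancestor s I).
Proof.
elim: s => [|s IH] //; rewrite ancestorS.
exact: subset_trans (@ditv_parent _ _).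
Qed.

Lemma ditv_meet_level (R : realType) (I J : dyadic) (x : R) :
  ditv R I x -> ditv R J x -> level I = level J -> I = J.
Proof.
by move: I J => [k i] [l j] /in_ditv /= <- /in_ditv /= <-; rewrite /level /= => ->.
Qed.

Definition desc (I J : dyadic) : Prop := exists s, ancestor s I = J.

Lemma desc_refl I : desc I I.
Proof. by exists 0%N. Qed.

Lemma desc_trans J I K : desc I J -> desc J K -> desc I K.
Proof. by move=> [s <-] [t <-]; exists (t + s)%N; rewrite ancestorD. Qed.

Lemma desc_ancestor s I : desc I (ancestor s I).
Proof. by exists s. Qed.

Lemma desc_sub (R : realType) (I J : dyadic) :
  desc I J -> ditv R I `<=` ditv R J.
Proof. by move=> [s <-]; exact: ditv_ancestor. Qed.

Lemma desc_level I J : desc I J -> level J <= level I.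
Proof. by move=> [s <-]; rewrite ancestor_level; lia. Qed.

Lemma meet_desc (R : realType) (I J : dyadic) (x : R) :
  ditv R I x -> ditv R J x -> level J <= level I -> desc I J.
Proof.
move=> Ix Jx lIJ; exists (`|level I - level J|%N).
apply: (@ditv_meet_level R _ _ x) => //; first exact: ditv_ancestor.
by rewrite ancestor_level; lia.
Qed.

Lemma desc_total (R : realType) (I J : dyadic) (x : R) :
  ditv R I x -> ditv R J x -> desc I J \/ desc J I.
Proof.
move=> Ix Jx; case: (leP (level J) (level I)) => h.
  by left; apply: meet_desc Jx h.
by right; apply: meet_desc Ix (ltW h).
Qed.

(** * Dyadic distance and finite neighbourhoods *)

Definition dnear (n : nat) (I J : dyadic) : Prop :=
  exists s t, (s + t <= n)%N /\ ancestor s I = ancestor t J.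

Lemma near_refl n I : dnear n I I.
Proof. by exists 0%N, 0%N. Qed.

Lemma near_sym n I J : dnear n I J -> dnear n J I.
Proof. by move=> [s [t [h e]]]; exists t, s; rewrite addnC. Qed.

(** A path from [I] to [J] climbs [s] generations and then descends. Climbing only [r < s] of them
    stays on the path; climbing [r >= s] reaches the common ancestor, which contains [J]. This moves
    intervals to stopping ancestors without increasing the distance. *)
Lemma near_ancestor n r I J : dnear n I J ->
  desc J (ancestor r I) \/ ((r <= n)%N /\ dnear n (ancestor r I) J).
Proof.
move=> [s [t [st e]]]; case: (leqP s r) => h.
  by left; exists (r - s + t)%N; rewrite ancestorD -e -ancestorD subnK.
right; split; first lia.
exists (s - r)%N, t; split; first lia.
by rewrite -ancestorD subnK // ltnW.
Qed.

Lemma ddist_near (R : realType) n (I J : dyadic) :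
  (ddist R I J <= n%:R%:E)%E <-> dnear n I J.
Proof.
split=> [h|[s [t [st e]]]]; last first.
  apply: (@le_trans _ _ (s + t)%:R%:E); last by rewrite lee_fin ler_nat.
  by apply: ereal_inf_lbound; exists (s, t).
(* Path lengths are integers, so an element of the set below [n + 1] is at most [n]; the infimum
   itself need not be exhibited as attained. *)
have lt : (ddist R I J < n.+1%:R%:E)%E.
  by apply: le_lt_trans h _; rewrite lte_fin ltr_nat.
have [_ [[s t] /= e <-] st] := ereal_inf_lt lt.
by exists s, t; split=> //; move: st; rewrite lte_fin ltr_nat ltnS.
Qed.

Lemma parent_child J K : parent J = K -> J = lchild K \/ J = rchild K.
Proof.
move: J => [k j] <-; rewrite /lchild /rchild /parent /=.
have e := divz_eq j 2; have := modz_ge0 j (isT : (2 : int) != 0).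
have := ltz_pmod j (isT : (0 : int) < 2) => h1 h2.
have [h|h] : (j %% 2)%Z = 0 \/ (j %% 2)%Z = 1 by lia.
  by left; congr (_, _); lia.
by right; congr (_, _); lia.
Qed.

Lemma parent_lchild K : parent (lchild K) = K.
Proof.
by case: K => k j; rewrite /parent /lchild /= addrK mulrC mulzK.
Qed.

Lemma parent_rchild K : parent (rchild K) = K.
Proof.
case: K => k j; rewrite /parent /rchild /= addrK mulrC divzMDl //.
by rewrite divz_small ?addr0.
Qed.

Fixpoint descs (t : nat) (K : dyadic) : seq dyadic :=
  if t is t'.+1 then descs t' (lchild K) ++ descs t' (rchild K) else [:: K].

Lemma mem_descs t J K : ancestor t J = K -> J \in descs t K.
Proof.
elim: t K => [|t IH] K; first by move=> /= ->; rewrite inE.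
by rewrite ancestorS mem_cat => /parent_child[/IH ->|/IH ->] //; rewrite orbT.
Qed.

Lemma size_descs t K : size (descs t K) = (2 ^ t)%N.
Proof. by elim: t K => [|t IH] K //=; rewrite size_cat !IH expnS; lia. Qed.

(** A list that covers the [n]-neighbourhood of [Q], with repetitions and some farther intervals.
    Its length is the same for every [Q], and this length is the constant D of the packing
    estimate. *)
Definition nears (n : nat) (Q : dyadic) : seq dyadic :=
  flatten [seq flatten [seq descs t (ancestor s Q) | t <- iota 0 n.+1]
          | s <- iota 0 n.+1].

Definition near_bound (n : nat) : nat :=
  (n.+1 * sumn [seq 2 ^ t | t <- iota 0 n.+1])%N.

Lemma near_bound_gt0 n : (0 < near_bound n)%N.
Proof. by rewrite /near_bound muln_gt0. Qed.

Lemma size_nears n Q : size (nears n Q) = near_bound n.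
Proof.
have e s : size (flatten [seq descs t (ancestor s Q) | t <- iota 0 n.+1]) =
    sumn [seq 2 ^ t | t <- iota 0 n.+1]%N.
  rewrite size_flatten /shape -map_comp; congr sumn; apply: eq_map => t /=.
  exact: size_descs.
rewrite /nears /near_bound size_flatten /shape -map_comp (eq_map (g := fun=>
    sumn [seq 2 ^ t | t <- iota 0 n.+1]%N)) //.
rewrite sumnE big_map big_const_seq count_predT size_iota iter_addn addn0.
exact: mulnC.
Qed.

Lemma mem_nears n Q J : dnear n Q J -> J \in nears n Q.
Proof.
move=> [s [t [st e]]]; apply/flattenP.
exists (flatten [seq descs t (ancestor s Q) | t <- iota 0 n.+1]).
  by apply/mapP; exists s => //; rewrite mem_iota; lia.
apply/flattenP; exists (descs t (ancestor s Q)); last exact/mem_descs.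
by apply/mapP; exists t => //; rewrite mem_iota; lia.
Qed.

(** A path of length at most 2 with no climb or no descent joins nested intervals, so one step up
    and one step down is all that remains. This is the configuration that [C_form] excludes by
    asking for distance above 2. *)
Lemma near_siblings I J : dnear 2 I J -> ~ desc I J -> ~ desc J I ->
  parent I = parent J.
Proof.
move=> [[|[|s]] [[|[|t]] [st e]]] nIJ nJI //; try by lia.
- by case: nIJ; exists 0%N.
- by case: nJI; exists 1%N.
- by case: nJI; exists t.+2.
- by case: nIJ; exists 1%N.
- by case: nIJ; exists s.+2.
Qed.

(** * Masses, balance and the coefficients [c1b] *)

Section mass_theory.
Context (R : realType) (mu : {measure set (measurableTypeR R) -> \bar R}).
Hypothesis mu_fin : forall I : dyadic, (0 < mu (ditv R I) < +oo)%E.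

Lemma measurable_ditv I : measurable (ditv R I : set (measurableTypeR R)).
Proof. exact: measurable_itv. Qed.

Lemma mu_ditv I : mu (ditv R I) = (mass mu I)%:E.
Proof.
rewrite /mass fineK // ge0_fin_numE ?measure_ge0 //.
by case/andP: (mu_fin I).
Qed.

Lemma mass_gt0 I : 0 < mass mu I.
Proof. by rewrite -lte_fin -mu_ditv; case/andP: (mu_fin I). Qed.

Lemma mass_le I J : desc I J -> mass mu I <= mass mu J.
Proof.
move=> IJ; rewrite -lee_fin -!mu_ditv; apply: le_measure.
- by rewrite inE; exact: measurable_ditv.
- by rewrite inE; exact: measurable_ditv.
- exact: desc_sub.
Qed.

Lemma mD_gt0 I : 0 < mD mu I.
Proof. by rewrite /mD divr_gt0 ?mulr_gt0 // mass_gt0. Qed.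

Lemma mD_le_mass I : mD mu I <= mass mu I.
Proof.
have l : desc (lchild I) I by exists 1%N; exact: parent_lchild.
have r : desc (rchild I) I by exists 1%N; exact: parent_rchild.
rewrite /mD ler_pdivrMr ?mass_gt0 //.
by apply: ler_pM; rewrite ?mass_le // ltW // mass_gt0.
Qed.

Lemma mD_siblings I J : I <> J -> parent I = parent J ->
  mD mu (parent J) = mass mu I * mass mu J / mass mu (parent J).
Proof.
move=> IJ e; rewrite /mD; congr (_ / _).
have [a|a] := parent_child e; have [b|b] := parent_child (erefl (parent J)).
- by case: IJ; rewrite a.
- by rewrite -a -b.
- by rewrite -a -b mulrC.
- by case: IJ; rewrite a.
Qed.

Variable c : R.
Hypothesis c_ge1 : 1 <= c.
Hypothesis mD_bal : forall I : dyadic,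
  c^-1 * mD mu (parent I) <= mD mu I <= c * mD mu (parent I).

Let c_gt0 : 0 < c. Proof. exact: lt_le_trans c_ge1. Qed.

(** By balance each step of the path, up or down, costs at most a factor [c]; there are at most [n]
    steps, and [c >= 1] absorbs the missing ones. *)
Lemma mD_near n I J : dnear n I J -> mD mu I <= c ^+ n * mD mu J.
Proof.
have up s K : mD mu K <= c ^+ s * mD mu (ancestor s K).
  elim: s => [|s IH]; first by rewrite expr0 mul1r.
  apply: le_trans IH _; rewrite exprSr -mulrA ler_pM2l ?exprn_gt0 //.
  by case/andP: (mD_bal (ancestor s K)).
have down s K : mD mu (ancestor s K) <= c ^+ s * mD mu K.
  elim: s => [|s IH]; first by rewrite expr0 mul1r.
  have /andP[h _] := mD_bal (ancestor s K).
  rewrite mulrC ler_pdivrMr // in h; apply: (le_trans h).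
  by rewrite exprS -mulrA mulrC ler_pM2l.
move=> [s [t [st e]]]; apply: le_trans (up s I) _; rewrite e.
apply: le_trans (_ : c ^+ s * (c ^+ t * mD mu J) <= _).
  by rewrite ler_pM2l ?exprn_gt0.
rewrite mulrA -exprD ler_pM2r ?mD_gt0 //; exact: ler_weXn2l.
Qed.

Lemma sqrt_mD_le n I J : dnear n I J ->
  Num.sqrt (mD mu I * mD mu J) <= c ^+ n * mD mu J.
Proof.
move=> IJ; have cn : 1 <= c ^+ n by exact: exprn_ege1.
have cn0 : 0 <= c ^+ n by exact: le_trans cn.
have j0 := mD_gt0 J; have h := mD_near IJ.
have -> : c ^+ n * mD mu J = Num.sqrt ((c ^+ n * mD mu J) ^+ 2).
  by rewrite sqrtr_sqr ger0_norm // mulr_ge0 // ltW.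
rewrite ler_sqrt ?sqr_ge0 //.
rewrite expr2; apply: ler_pM => //; rewrite ?(ltW (mD_gt0 _)) //.
by rewrite ler_peMl // ltW.
Qed.

Lemma c1b_le n I J : dnear n I J -> c1b mu I J <= c ^+ n.
Proof.
rewrite /c1b; case: eqP => _ IJ; first exact: exprn_ege1.
rewrite ler_pdivrMr ?mass_gt0 //; apply: le_trans (sqrt_mD_le IJ) _.
by rewrite ler_pM2l ?exprn_gt0 // mD_le_mass.
Qed.

Lemma c1b_gt0 I J : 0 < c1b mu I J.
Proof.
rewrite /c1b; case: eqP => // _.
by rewrite divr_gt0 ?mass_gt0 // sqrtr_gt0 mulr_gt0 ?mD_gt0.
Qed.

(** Off the diagonal, the coefficient divided by [mass mu I] is symmetric in [I] and [J], so the two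
    masses may be exchanged; then balance and [mD_le_mass] bound the square root by
    [c ^+ n * mass mu I]. *)
Lemma c1b_mean_le n I J (a : R) : 0 <= a -> dnear n I J ->
  c1b mu I J * (a / mass mu I) <= c ^+ n * (a / mass mu J).
Proof.
move=> a0 IJ; have cn : 1 <= c ^+ n by exact: exprn_ege1.
rewrite /c1b; case: eqP => [->|_].
  by rewrite ler_wpM2r // divr_ge0 // ltW // mass_gt0.
rewrite mulrACA [X in _ * X]mulrC mulrACA.
apply: ler_wpM2r; first by rewrite divr_ge0 // ltW // mass_gt0.
rewrite ler_pdivrMr ?mass_gt0 // mulrC.
apply: le_trans (sqrt_mD_le (near_sym IJ)) _.
by rewrite ler_pM2l ?exprn_gt0 // mD_le_mass.
Qed.

(** Off the diagonal, coefficient times mass is [Num.sqrt (mD mu I * mD mu J)], which balance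
    controls when [J] moves to a nearby interval. The diagonal value 1 does not have this form,
    hence the two inequalities. *)
Lemma c1b_transfer n I J J' : dnear n J' J -> I <> J -> I <> J' ->
  c1b mu I J' * mass mu J' <= c ^+ n * (c1b mu I J * mass mu J).
Proof.
move=> h /eqP/negbTE e /eqP/negbTE e'; rewrite /c1b e e'.
rewrite !divfK ?gt_eqF ?mass_gt0 //.
have cn : 1 <= c ^+ n by exact: exprn_ege1.
have i0 := mD_gt0 I; have j0 := mD_gt0 J; have j0' := mD_gt0 J'.
rewrite (sqrtrM (mD mu J') (ltW i0)) (sqrtrM (mD mu J) (ltW i0)).
rewrite mulrCA ler_pM2l ?sqrtr_gt0 //.
have -> : c ^+ n = Num.sqrt ((c ^+ n) ^+ 2).
  by rewrite sqrtr_sqr ger0_norm // (le_trans ler01).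
rewrite -(sqrtrM (mD mu J) (sqr_ge0 _)).
rewrite ler_sqrt; last exact: mulr_ge0 (sqr_ge0 _) (ltW j0).
apply: le_trans (mD_near h) _.
by rewrite ler_pM2r // expr2 ler_peMl // (le_trans ler01).
Qed.

End mass_theory.

(** * Unordered countable sums as series, and their integrals *)

Section countable_esum.
Context (R : realType) (T : countType).
Implicit Types (P : set T) (a : T -> \bar R).

(* [pickle_inv], unlike [unpickle], is injective where it is defined. *)
Definition pickled P a (n : nat) : \bar R :=
  if pickle_inv n is Some i then if i \in P then a i else 0%E else 0%E.

Lemma pickled_ge0 P a n : (forall i, P i -> (0 <= a i)%E) ->
  (0 <= pickled P a n)%E.
Proof.
move=> a0; rewrite /pickled; case: pickle_inv => // i.
by case: ifPn => //; rewrite inE => /a0.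
Qed.

Lemma esum_countable P a : (forall i, P i -> (0 <= a i)%E) ->
  (\esum_(i in P) a i = \sum_(n <oo) pickled P a n)%E.
Proof.
move=> a0; rewrite nneseries_esumT => [|n]; last exact: pickled_ge0.
have -> : (\esum_(i in P) a i = \esum_(i in P) pickled P a (pickle i))%E.
  by apply: eq_esum => i Pi; rewrite /pickled pickleK_inv mem_set.
rewrite -(esum_image P pickle) => [|i j _ _]; last exact: (pcan_inj pickleK_inv).
rewrite esum_mkcond; apply: eq_esum => n _; case: ifPn => // nP.
rewrite /pickled; case e: (pickle_inv n) => [i|] //; case: ifPn => // iP.
move: nP; rewrite notin_setE => -[]; exists i; first exact/set_mem.
by have := pickle_invK n (T := T); rewrite e.
Qed.

End countable_esum.

Section countable_measure.
Context d (X : measurableType d) (R : realType) (T : countType).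
Variable mu : {measure set X -> \bar R}.

Lemma countable_bigcup_measurable (P : set T) (V : T -> set X) :
  (forall i, measurable (V i)) -> measurable (\bigcup_(i in P) V i).
Proof.
move=> mV; rewrite bigcup_mkcond; apply: countable_bigcupT_measurable.
  exact: countableP.
by move=> i; case: ifP.
Qed.

Lemma measure_bigcup_le_esum (P : set T) (V : T -> set X) :
  (forall i, measurable (V i)) ->
  (mu (\bigcup_(i in P) V i) <= \esum_(i in P) mu (V i))%E.
Proof.
move=> mV; rewrite esum_countable => [|i _]; last exact: measure_ge0.
pose W n := if pickle_inv n is Some i then if i \in P then V i else set0 else set0.
apply: (@le_trans _ _ (\sum_(n <oo) mu (W n))%E).
  apply: measure_sigma_subadditive.
  - by move=> n; rewrite /W; case: pickle_inv => // i; case: ifP.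
  - exact: countable_bigcup_measurable.
  - move=> x [i Pi Vx]; exists (pickle i) => //.
    by rewrite /W pickleK_inv mem_set.
apply: lee_nneseries => [n _ _|n _]; first exact: measure_ge0.
rewrite /W /pickled; case: pickle_inv => [i|]; last by rewrite measure0.
by case: ifP => // _; rewrite measure0.
Qed.

Variables (P : set T) (g : T -> X -> \bar R).
Hypothesis g_ge0 : forall i x, P i -> (0 <= g i x)%E.
Hypothesis g_meas : forall i, P i -> measurable_fun [set: X] (g i).

Let pickled_meas n : measurable_fun [set: X] (fun x => pickled P (g ^~ x) n).
Proof.
rewrite /pickled; case: pickle_inv => [i|] //; case: (boolP (i \in P)) => // iP.
by apply: g_meas; exact: set_mem iP.
Qed.

Lemma measurable_esum :
  measurable_fun [set: X] (fun x => (\esum_(i in P) g i x)%E).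
Proof.
rewrite (_ : (fun x => _) = (fun x => \sum_(n <oo) pickled P (g ^~ x) n)%E).
  apply: ge0_emeasurable_sum => // n x _ _.
  by apply: pickled_ge0 => i; exact: g_ge0.
by apply/funext => x; rewrite esum_countable // => i; exact: g_ge0.
Qed.

Lemma integral_esum :
  (\int[mu]_x (\esum_(i in P) g i x) = \esum_(i in P) \int[mu]_x (g i x))%E.
Proof.
transitivity (\int[mu]_x (\sum_(n <oo) pickled P (g ^~ x) n))%E.
  apply: eq_integral => x _; rewrite esum_countable // => i; exact: g_ge0.
rewrite integral_nneseries //; last first.
  by move=> n x _; apply: pickled_ge0 => i; exact: g_ge0.
rewrite esum_countable => [|i Pi]; last first.
  by apply: integral_ge0 => x _; exact: g_ge0.
apply: eq_eseriesr => n _; rewrite /pickled.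
case: pickle_inv => [i|]; last by rewrite integral0.
by case: (i \in P) => //; rewrite integral0.
Qed.

End countable_measure.

(* No measurability is needed of the smaller function: every simple function
   below it is below the larger one. *)
Lemma ge0_integral_mono d (X : measurableType d) (R : realType)
    (mu : {measure set X -> \bar R}) (f g : X -> \bar R) :
  (forall x, (0 <= f x)%E) -> (forall x, (f x <= g x)%E) ->
  (\int[mu]_x f x <= \int[mu]_x g x)%E.
Proof.
move=> f0 fg; have g0 x : (0 <= g x)%E by exact: le_trans (fg x).
rewrite !ge0_integralTE //; apply: le_ereal_sup => _ [h hf <-].
by exists h => // x; apply: le_trans (hf x) (fg x).
Qed.

(** * Integrals over dyadic intervals *)

Section dyadic_integrals.
Context (R : realType) (mu : {measure set (measurableTypeR R) -> \bar R}).
Variable f : R -> R.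
Hypothesis f_int : mu.-integrable [set: measurableTypeR R] (EFin \o f).
Hypothesis f_ge0 : forall x, 0 <= f x.

Definition dint (I : dyadic) : R := fine (\int[mu]_(x in ditv R I) (f x)%:E).

Let f_measurable : measurable_fun [set: measurableTypeR R] (EFin \o f).
Proof. by case/integrableP: f_int. Qed.

Lemma dintE I : (\int[mu]_(x in ditv R I) (f x)%:E = (dint I)%:E)%E.
Proof.
rewrite /dint fineK //; apply: integrable_fin_num; first exact: measurable_ditv.
by apply: (integrableS measurableT) f_int => //; exact: measurable_ditv.
Qed.

Lemma dint_ge0 I : 0 <= dint I.
Proof. by apply: fine_ge0; apply: integral_ge0 => x _; rewrite lee_fin. Qed.

(** Comparing only on the support lets [I] be larger than [J], as happens for intervals above the
    top level of the stopping family. *)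
Lemma dint_le_supp I J : (forall x, ditv R I x -> f x != 0 -> ditv R J x) ->
  dint I <= dint J.
Proof.
move=> h; rewrite -lee_fin -!dintE integral_mkcond [leRHS]integral_mkcond.
apply: ge0_integral_mono => x; rewrite !patchE.
  by case: ifP; rewrite ?lee_fin.
case: ifPn => //= xI; last by case: ifP; rewrite ?lee_fin.
case: ifPn => // /negP xJ; case: (eqVneq (f x) 0) => [->//|fx].
by case: xJ; rewrite inE; apply: h => //; exact: set_mem xI.
Qed.

Lemma dint_le I J : desc I J -> dint I <= dint J.
Proof. by move=> IJ; apply: dint_le_supp => x Ix _; apply: desc_sub Ix. Qed.

Lemma dint_eq0 I : (forall x, ditv R I x -> f x = 0) -> dint I = 0.
Proof.
by move=> h; rewrite /dint integral0_eq // => x /h ->.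
Qed.

Lemma avgE I : avg mu f I = (dint I / mass mu I)%:E.
Proof. by rewrite /avg dintE -EFinM mulrC. Qed.

Lemma esum_dint_le (G : set dyadic) J :
  trivIset G (ditv R) -> (forall Q, G Q -> desc Q J) ->
  (\esum_(Q in G) (dint Q)%:E <= (dint J)%:E)%E.
Proof.
move=> tG GJ; apply: ge_ereal_sup => _ [X [finX XG] <-].
rewrite fsbig_finite //= -dintE.
under eq_bigr do rewrite -dintE.
rewrite -(@ge0_integral_bigsetU _ _ R mu _ (ditv R) (EFin \o f)).
- apply: ge0_subset_integral.
  + by apply: bigsetU_measurable => Q _; exact: measurable_ditv.
  + exact: measurable_ditv.
  + exact: measurable_funS measurableT _ f_measurable.
  + by move=> x _; rewrite lee_fin.
  + rewrite -bigcup_seq => x [Q /= QX]; apply: desc_sub; apply/GJ/XG.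
    by move: QX; rewrite in_fset_set // inE.
- by move=> Q; exact: measurable_ditv.
- exact: finmap.fset_uniq.
- by apply: sub_trivIset tG => Q /=; rewrite in_fset_set // inE; exact: XG.
- exact: measurable_funS measurableT _ f_measurable.
- by move=> x _; rewrite lee_fin.
Qed.

End dyadic_integrals.

(** * Maximal intervals and unions over lists *)

Section packing.
Context (R : realType) (mu : {measure set (measurableTypeR R) -> \bar R}).
Hypothesis mu_fin : forall I : dyadic, (0 < mu (ditv R I) < +oo)%E.

(** Only finitely many ancestors of [I] lie below [J]; the highest one in [G] is maximal. *)
Lemma exists_maximal (G : set dyadic) (J I : dyadic) :
  (forall Q, G Q -> desc Q J) -> G I ->
  exists Q, [/\ G Q, desc I Q & forall Q', G Q' -> desc Q Q' -> Q' = Q].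
Proof.
move=> GJ GI; have [s sI] := GJ _ GI.
pose p r := `[< (r <= s)%N /\ G (ancestor r I) >].
have p0 : exists r, p r by exists 0%N; apply/asboolP.
have ps r : p r -> (r <= s)%N by move=> /asboolP[].
have [r /asboolP[rs Gr] rmax] := ex_maxnP p0 ps.
exists (ancestor r I); split=> //; first exact: desc_ancestor.
move=> _ /[swap] [[t <-]]; rewrite -ancestorD => Gt.
suff : (t + r <= r)%N by move=> h; congr ancestor; lia.
apply: rmax; apply/asboolP; split=> //.
have /desc_level := GJ _ Gt; rewrite -sI !ancestor_level; lia.
Qed.

(** The predicate [P] discards those entries of a list such as [nears n Q] for which no bound on the
    mass is available. *)
Lemma mu_seq_union_le (s : seq dyadic) (P : set dyadic) (b : R) : 0 <= b ->
  (forall J, P J -> mass mu J <= b) ->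
  (mu (\bigcup_(J in [set J | J \in s /\ P J]) ditv R J)
     <= ((size s)%:R * b)%:E)%E.
Proof.
move=> b0 Pb; elim: s => [|a s IH].
  rewrite mul0r (_ : \bigcup_(_ in _) _ = set0) ?measure0 //.
  by rewrite -subset0 => x [J []].
have mU : measurable
    (\bigcup_(J in [set J | J \in s /\ P J]) ditv R J : set (measurableTypeR R)).
  by apply: countable_bigcup_measurable => J; exact: measurable_ditv.
have mV : measurable
    (\bigcup_(J in [set J | J = a /\ P J]) ditv R J : set (measurableTypeR R)).
  by apply: countable_bigcup_measurable => J; exact: measurable_ditv.
apply: (@le_trans _ _ (mu (\bigcup_(J in [set J | J = a /\ P J]) ditv R J `|`
   \bigcup_(J in [set J | J \in s /\ P J]) ditv R J))).
  apply: le_measure; rewrite ?inE.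
  - by apply: countable_bigcup_measurable => J; exact: measurable_ditv.
  - exact: measurableU.
  - move=> x [J [/= + PJ] Jx]; rewrite inE => /orP[/eqP e|Js]; [left|right].
      by exists J.
    by exists J.
apply: le_trans (measureU2 _ mV mU) _.
rewrite /= -natr1 mulrDl mul1r addrC EFinD; apply: leeD => //.
case: (pselect (P a)) => Pa.
  apply: (@le_trans _ _ (mu (ditv R a))); last by rewrite mu_ditv // lee_fin Pb.
  apply: le_measure; rewrite ?inE //; first exact: measurable_ditv.
  by move=> x [J [-> _]].
rewrite (_ : \bigcup_(_ in _) _ = set0) ?measure0 ?lee_fin //.
by rewrite -subset0 => x [J [/= -> /Pa]].
Qed.

End packing.

Lemma esumZl_le (R : realType) (T : choiceType) (P : set T) (a : T -> \bar R)
    (k : R) : 0 <= k -> (forall i, 0 <= a i)%E ->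
  (\esum_(i in P) (k%:E * a i) <= k%:E * \esum_(i in P) a i)%E.
Proof.
move=> k0 a0; apply: ge_ereal_sup => _ [X [finX XP] <-].
rewrite -ge0_mule_fsumr //; apply: lee_pmul => //.
  by apply: fsume_ge0 => i _.
by apply: esum_ge; exists X.
Qed.

(** * The stopping condition and its packing estimate *)

Section stopping_condition.
Context (R : realType) (mu : {measure set (measurableTypeR R) -> \bar R}).
Hypothesis mu_fin : forall I : dyadic, (0 < mu (ditv R I) < +oo)%E.
Variable c : R.
Hypothesis c_ge1 : 1 <= c.
Hypothesis mD_bal : forall I : dyadic,
  c^-1 * mD mu (parent I) <= mD mu I <= c * mD mu (parent I).
Variable f : R -> R.
Hypothesis f_int : mu.-integrable [set: measurableTypeR R] (EFin \o f).
Hypothesis f_ge0 : forall x, 0 <= f x.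
Variable n : nat.

Definition mean (I : dyadic) : R := dint mu f I / mass mu I.

(** This is the factor A of the overview. It makes [near_bound n * (c ^+ n / jump)] equal to 1/4, so
    that two sources of jumps fill at most half of an interval. *)
Definition jump : R := 4 * (near_bound n)%:R * c ^+ n.

(* The second clause says that the supremum of c(I,.)<f>_I jumps, without
   mentioning the supremum itself. *)
Definition jumps (J J' : dyadic) : Prop :=
  jump * mean J < mean J' \/
  exists2 I', dnear n I' J' & forall I, dnear n I J ->
    jump * (c1b mu I J * mean I) < c1b mu I' J' * mean I'.

Let mass_gt0 I : 0 < mass mu I. Proof. exact: mass_gt0. Qed.
Let cn_ge1 : 1 <= c ^+ n. Proof. exact: exprn_ege1. Qed.
Let cn_gt0 : 0 < c ^+ n. Proof. exact: lt_le_trans cn_ge1. Qed.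
Let D_ge1 : 1 <= (near_bound n)%:R :> R.
Proof. by rewrite ler1n near_bound_gt0. Qed.

Lemma jump_gt0 : 0 < jump.
Proof. by rewrite !mulr_gt0 // (lt_le_trans ltr01). Qed.

Lemma jump_ge : c ^+ n <= jump.
Proof. by rewrite /jump ler_peMl // ?(ltW cn_gt0) //; have := D_ge1; lra. Qed.

Lemma jump_ge1 : 1 <= jump.
Proof. exact: le_trans jump_ge. Qed.

Lemma mean_ge0 I : 0 <= mean I.
Proof. by rewrite divr_ge0 ?dint_ge0 // ltW. Qed.

Lemma mean_mass I : mean I * mass mu I = dint mu f I.
Proof. by rewrite divfK // gt_eqF. Qed.

(** Normalised so that [near_bound n * kappa J * dint mu f J] is a quarter of [mass mu J] when the
    integral is nonzero. *)
Let kappa J := c ^+ n * mass mu J / (jump * dint mu f J).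
(** The factor [c ^+ n] on the right allows for the largest value of a coefficient [c1b mu I' J'] at
    distance at most [n]. *)
Let big J : set dyadic :=
  [set Q | desc Q J /\ jump * mean J < c ^+ n * mean Q].
Let maxbig J : set dyadic :=
  [set Q | big J Q /\ forall Q', big J Q' -> desc Q Q' -> Q' = Q].

Let big_dint_gt0 J Q : big J Q -> 0 < dint mu f J.
Proof.
move=> [QJ h]; apply: lt_le_trans (dint_le f_int f_ge0 QJ).
rewrite -mean_mass mulr_gt0 // -(pmulr_rgt0 _ cn_gt0).
by apply: le_lt_trans h; rewrite mulr_ge0 ?mean_ge0 // ltW // jump_gt0.
Qed.

Let kappa_bound J Q J' : big J Q ->
  jump * mean J < c ^+ n * (dint mu f Q / mass mu J') ->
  mass mu J' <= kappa J * dint mu f Q.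
Proof.
move=> /big_dint_gt0 J0; rewrite /mean /kappa.
move: jump_gt0 J0 (mass_gt0 J) (mass_gt0 J').
move: jump (dint mu f J) (mass mu J) (mass mu J') => a x y z a0 x0 y0 z0.
rewrite [in leRHS]mulrAC ler_pdivlMr ?mulr_gt0 // !mulrA.
rewrite ltr_pdivlMr // mulrAC ltr_pdivrMr // => /ltW.
by rewrite -mulrA [z * _]mulrC [leRHS]mulrAC.
Qed.

Let jumps_inside J J' : desc J' J -> jumps J J' ->
  (exists2 Q, maxbig J Q & J' \in nears n Q /\ mass mu J' <= kappa J * dint mu f Q)
  \/ (exists2 Q, maxbig J Q & desc J' Q)
  \/ (J' \in nears n J /\ mass mu J' <= c ^+ n / jump * mass mu J).
Proof.
move=> J'J jJ.
(* The case of a witness [I'] inside [J]. It also serves the first clause of [jumps], with [I' = J']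
   and coefficient 1. *)
have inside I' : desc I' J -> dnear n I' J' ->
    jump * mean J < c1b mu I' J' * mean I' ->
    (exists2 Q, maxbig J Q & J' \in nears n Q /\ mass mu J' <= kappa J * dint mu f Q)
  \/ (exists2 Q, maxbig J Q & desc J' Q).
  move=> I'J nI'J' h.
  have bI' : big J I'.
    split=> //; apply: lt_le_trans h _.
    by rewrite ler_wpM2r ?mean_ge0 // c1b_le.
  have [Q [bQ [r rQ] Qmax]] := exists_maximal (fun Q => @proj1 _ _) bI'.
  (* Climb from [I'] to the maximal interval [Q]: either this swallows [J'], or [Q] is still near
     [J']. *)
  have [J'Q|[_ nQ]] := near_ancestor r nI'J'; [right|left]; exists Q => //.
    by rewrite -rQ.
  rewrite rQ in nQ; split; first exact: mem_nears.
  apply: kappa_bound bQ _; apply: lt_le_trans h _.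
  apply: le_trans (c1b_mean_le mu_fin c_ge1 mD_bal (dint_ge0 _ _ _) nI'J') _ => //.
  rewrite ler_pM2l // ler_pM2r ?invr_gt0 //; apply: dint_le => //.
  by exists r.
case: jJ => [h|[I' nI' hI']].
  have : jump * mean J < c1b mu J' J' * mean J' by rewrite /c1b eqxx mul1r.
  by move=> /(inside _ J'J (near_refl _ _))[]; [left|right; left].
have hJ : jump * mean J < c1b mu I' J' * mean I'.
  by have := hI' J (near_refl _ _); rewrite {1}/c1b eqxx mul1r.
case: (pselect (desc I' J)) => I'J.
  by have [] := inside _ I'J nI' hJ; [left|right; left].
right; right.
(* The witness is not inside [J]. The path from it to [J'] must then pass through [J] on its way
   down, so [J'] is at most [n] generations below [J] and [I'] is near [J]. *)
have [s [t [st e]]] := nI'; have [r rJ] := J'J.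
have rt : (r <= t)%N.
  rewrite leqNgt; apply/negP => tr; apply: I'J; exists (r - t + s)%N.
  by rewrite ancestorD e -ancestorD subnK // ltnW.
have nI'J : dnear n I' J.
  by exists s, (t - r)%N; split; [lia|rewrite -rJ -ancestorD subnK].
have nJ'J : dnear n J' J by exists r, 0%N; split; [lia|].
split; first exact: mem_nears (near_sym nJ'J).
have ne : I' <> J by move=> h; apply: I'J; rewrite h; exact: desc_refl.
have ne' : I' <> J' by move=> h; apply: I'J; rewrite h.
(* Testing the jump of the supremum against [I'] itself lets [mean I'] cancel, leaving a jump of the
   coefficient alone; [c1b_transfer] turns it into smallness of [mass mu J']. *)
have := hI' _ nI'J; rewrite mulrA => h.
have m0 : 0 < mean I'.
  rewrite lt_neqAle mean_ge0 andbT eq_sym; apply/eqP => m0.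
  by move: h; rewrite m0 !mulr0 ltxx.
rewrite ltr_pM2r // in h.
have tr := c1b_transfer mu_fin c_ge1 mD_bal nJ'J ne ne'.
rewrite mulrAC ler_pdivlMr ?jump_gt0 //.
have cJ := c1b_gt0 mu_fin I' J.
rewrite -(ler_pM2l cJ); apply: le_trans (_ : c1b mu I' J' * mass mu J' <= _).
  by rewrite [_ * jump]mulrC mulrA [_ * jump]mulrC ler_pM2r // ltW.
by apply: le_trans tr _; rewrite mulrCA.
Qed.

(** The set [V Q] collects the light neighbours of a maximal interval [Q], and [W] those of [J]
    itself. Each of the two families contributes at most a quarter of the mass. *)
Lemma mu_jumps_le J :
  (mu (\bigcup_(J' in [set J' | desc J' J /\ jumps J J']) ditv R J')
     <= (2^-1 * mass mu J)%:E)%E.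
Proof.
pose V Q : set (measurableTypeR R) := \bigcup_(J' in
  [set J' | J' \in nears n Q /\ mass mu J' <= kappa J * dint mu f Q]) ditv R J'.
pose W : set (measurableTypeR R) := \bigcup_(J' in
  [set J' | J' \in nears n J /\ mass mu J' <= c ^+ n / jump * mass mu J]) ditv R J'.
have mditv P : measurable (\bigcup_(I in P) ditv R I : set (measurableTypeR R)).
  by apply: countable_bigcup_measurable => I; exact: measurable_ditv.
have mVs : measurable (\bigcup_(Q in maxbig J) V Q).
  by apply: countable_bigcup_measurable => Q; exact: mditv.
have k0 : 0 <= kappa J.
  apply: divr_ge0; first by rewrite mulr_ge0 // ltW.
  by apply: mulr_ge0; [exact/ltW/jump_gt0|exact: dint_ge0].
have j0 := jump_gt0.
have cj0 : 0 <= c ^+ n / jump by apply: divr_ge0; apply: ltW.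
have Dcj : (near_bound n)%:R * (c ^+ n / jump) = 4^-1.
  rewrite /jump; field.
  by rewrite !gt_eqF // (lt_le_trans ltr01).
(* [Q] is one of its own light neighbours, so [V Q] also covers every jumping interval inside
   [Q]. *)
have selfV Q : maxbig J Q -> ditv R Q `<=` V Q.
  move=> [[QJ bQ] _] x Qx; exists Q => //; split; first exact/mem_nears/near_refl.
  exact: kappa_bound.
apply: (@le_trans _ _ (mu (\bigcup_(Q in maxbig J) V Q `|` W))).
  apply: le_measure; rewrite ?inE; first exact: mditv.
    by apply: measurableU; [exact: mVs|exact: mditv].
  move=> x [J' [J'J jJ] J'x].
  have [[Q mQ h]|[[Q mQ J'Q]|h]] := jumps_inside J'J jJ.
  - by left; exists Q => //; exists J'.
  - by left; exists Q => //; apply: selfV => //; exact: desc_sub J'x.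
  - by right; exists J'.
apply: le_trans (measureU2 mu mVs (mditv _)) _.
have -> : 2^-1 * mass mu J = 4^-1 * mass mu J + 4^-1 * mass mu J by lra.
rewrite EFinD; apply: leeD; last first.
  have := mu_seq_union_le mu_fin (nears n J)
    (P := fun J' => mass mu J' <= _) _ (fun J' h => h).
  move=> /(_ (c ^+ n / jump * mass mu J)); rewrite size_nears mulrA Dcj; apply.
  by rewrite mulr_ge0 // ltW.
apply: le_trans (measure_bigcup_le_esum mu _ _) _; first by move=> Q; exact: mditv.
apply: (@le_trans _ _ (\esum_(Q in maxbig J)
    (((near_bound n)%:R * kappa J)%:E * (dint mu f Q)%:E))%E).
  apply: le_esum => Q _; rewrite -EFinM -mulrA -(size_nears n Q).
  apply: (mu_seq_union_le mu_fin) => //.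
  by rewrite mulr_ge0 // dint_ge0.
apply: le_trans (esumZl_le _ _ _) _.
- by rewrite mulr_ge0 // (le_trans ler01).
- by move=> Q; rewrite lee_fin dint_ge0.
apply: (@le_trans _ _ (((near_bound n)%:R * kappa J)%:E * (dint mu f J)%:E)%E).
  apply: lee_wpmul2l; first by rewrite lee_fin mulr_ge0 // (le_trans ler01).
  apply: esum_dint_le => //; last by move=> Q [[]].
  (* Maximal intervals that meet are nested, hence equal. *)
  move=> Q Q' [bQ mQ] [bQ' mQ'] [x [Qx Q'x]].
  have [h|h] := desc_total Qx Q'x; last exact: mQ'.
  by rewrite (mQ Q').
rewrite -EFinM lee_fin /kappa.
have [-> | F0] := eqVneq (dint mu f J) 0; first by rewrite mulr0 mulr_ge0 // ltW.
rewrite -Dcj; move: F0 j0; move: (dint mu f J) jump => x j x0 /gt_eqF/negbT j0.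
by rewrite le_eqVlt; apply/orP; left; apply/eqP; field; rewrite j0 x0.
Qed.

End stopping_condition.

(** * Stopping families and sparseness *)

Section stopping_family.
(* The intervals of length 2^k, of level -k, are all taken as top intervals. *)
Variables (B : dyadic -> dyadic -> Prop) (k : nat).

(** The family is encoded by the map sending an interval to the smallest stopped interval containing
    it; its members are the fixed points. The argument [m] is the depth below the top level. *)
Fixpoint stop_at (m : nat) (J : dyadic) : dyadic :=
  if m is m'.+1 then
    let Q := stop_at m' (parent J) in if `[< B Q J >] then J else Q
  else J.

(** The absolute value is the depth of [J] only when [- k%:Z <= level J], a range to which the facts
    below are restricted. *)
Definition stop (J : dyadic) : dyadic := stop_at (absz (level J + k%:Z)) J.

Definition stopped : set dyadic := [set J | - k%:Z <= level J /\ stop J = J].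

Lemma stop_top J : level J = - k%:Z -> stop J = J.
Proof. by rewrite /stop => ->; rewrite addNr. Qed.

Lemma stop_rec J : - k%:Z < level J ->
  stop J = if `[< B (stop (parent J)) J >] then J else stop (parent J).
Proof.
move=> h; rewrite /stop.
have -> : level (parent J) = level J - 1 by [].
by have -> : absz (level J + k%:Z) = (absz (level J - 1 + k%:Z)).+1 by lia.
Qed.

Lemma stop_ind (P : dyadic -> Prop) :
  (forall J, level J = - k%:Z -> P J) ->
  (forall J, - k%:Z < level J -> P (parent J) -> P J) ->
  forall J, - k%:Z <= level J -> P J.
Proof.
move=> P0 PS J hJ; have [m] := ex_intro (eq (absz (level J + k%:Z))) _ erefl.
elim: m J hJ => [|m IH] J hJ e; first by apply: P0; lia.
have l : level (parent J) = level J - 1 by [].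
by apply: PS; [lia|apply: IH; rewrite l; lia].
Qed.

Lemma desc_stop J : - k%:Z <= level J -> desc J (stop J).
Proof.
move: J; apply: stop_ind => J hJ; first by rewrite stop_top //; exact: desc_refl.
move=> IH; rewrite stop_rec //; case: ifP => _; first exact: desc_refl.
by apply: desc_trans IH; exists 1%N.
Qed.

Lemma stopped_stop J : - k%:Z <= level J -> stopped (stop J).
Proof.
move: J; apply: stop_ind => J hJ; first by split; rewrite !stop_top // hJ.
move=> IH; rewrite stop_rec //; case: ifP => // b.
by split; [exact: ltW|rewrite stop_rec // b].
Qed.

Lemma stopP J : - k%:Z <= level J -> stop J = J \/ ~ B (stop J) J.
Proof.
rewrite le_eqVlt => /orP[/eqP/esym/stop_top ->|hJ]; first by left.
by rewrite stop_rec //; case: asboolP => b; [left|right].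
Qed.

(** Going down from [Q] to [J], the stopping ancestor remains [Q] until an interval satisfies [B Q];
    that interval is the [Q'] of the second alternative. *)
Lemma stopped_chain Q J : stopped Q -> - k%:Z <= level J -> desc J Q ->
  stop J = Q \/ exists Q', [/\ desc J Q', desc Q' Q & B Q Q'].
Proof.
move=> [hQ sQ] hJ [s]; elim: s J hJ => [|s IH] J hJ; first by move=> /= ->; left.
move=> e; have hs : - k%:Z < level J.
  by move: hQ; rewrite -e ancestor_level; lia.
rewrite /ancestor iterSr -/(ancestor s (parent J)) in e.
have hp : - k%:Z <= level (parent J).
  by have -> : level (parent J) = level J - 1 by []; lia.
have dJ : desc J (parent J) by exists 1%N.
have [sp|[Q' [d1 d2 b]]] := IH _ hp e; last first.
  by right; exists Q'; split=> //; exact: desc_trans dJ d1.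
rewrite stop_rec // sp; case: asboolP => b; last by left.
right; exists J; split=> //; first exact: desc_refl.
by exists s.+1; rewrite /ancestor iterSr.
Qed.

Context (R : realType) (mu : {measure set (measurableTypeR R) -> \bar R}).
Hypothesis mu_fin : forall I : dyadic, (0 < mu (ditv R I) < +oo)%E.
Hypothesis mu_B : forall J,
  (mu (\bigcup_(J' in [set J' | desc J' J /\ B J J']) ditv R J')
     <= (2^-1 * mass mu J)%:E)%E.

(** Take for [E] the interval minus everything that jumps from it, which keeps half of the mass. A
    stopped interval strictly inside [Q] lies in the removed part by [stopped_chain], whence
    disjointness. *)
Lemma stopped_sparse : sparse_family mu 2^-1 stopped.
Proof.
pose U J : set (measurableTypeR R) :=
  \bigcup_(J' in [set J' | desc J' J /\ B J J']) ditv R J'.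
have mU J : measurable (U J).
  by apply: countable_bigcup_measurable => J'; exact: measurable_ditv.
have mE J : measurable (ditv R J `\` U J : set (measurableTypeR R)).
  by apply: measurableD; [exact: measurable_ditv|exact: mU].
exists (fun J => ditv R J `\` U J); split => [I _|I _|I _|] //.
- have : (mu (ditv R I) <= mu (ditv R I `\` U I) + mu (U I))%E.
    apply: le_trans (measureU2 mu (mE I) (mU I)).
    apply: le_measure; rewrite ?inE; [exact: measurable_ditv|exact: measurableU|].
    by move=> x Ix; case: (pselect (U I x)) => h; [right|left].
  move=> /le_trans /(_ (leeD (le_refl _) (mu_B I))).
  rewrite mu_ditv // -leeBlDr // -EFinB -EFinM; apply: le_trans.
  by rewrite lee_fin; lra.
- have key Q Q' x : stopped Q -> stopped Q' -> desc Q' Q ->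
      (ditv R Q `\` U Q) x -> ditv R Q' x -> Q = Q'.
    move=> SQ SQ' d [_ nU] Q'x; have [h sQ'] := SQ'.
    have [|[Q2 [d1 d2 b]]] := stopped_chain SQ h d; first by rewrite sQ'.
    by case: nU; exists Q2 => //; exact: desc_sub Q'x.
  move=> Q Q' SQ SQ' [x [Ex E'x]].
  have [Qx _] := Ex; have [Q'x _] := E'x.
  have [d|d] := desc_total Qx Q'x; last exact: key Ex Q'x.
  by apply/esym; apply: key E'x Qx.
Qed.

End stopping_family.

(** * Pointwise domination of the maximal operator *)

Section pointwise.
Context (R : realType) (mu : {measure set (measurableTypeR R) -> \bar R}).
Hypothesis mu_fin : forall I : dyadic, (0 < mu (ditv R I) < +oo)%E.
Variable c : R.
Hypothesis c_ge1 : 1 <= c.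
Hypothesis mD_bal : forall I : dyadic,
  c^-1 * mD mu (parent I) <= mD mu I <= c * mD mu (parent I).
Variable f : R -> R.
Hypothesis f_int : mu.-integrable [set: measurableTypeR R] (EFin \o f).
Hypothesis f_ge0 : forall x, 0 <= f x.
Variables n k : nat.

(** The interval from [- 2 ^ k] to [2 ^ k], as two top intervals: no dyadic interval straddles the
    origin, so the two halves have no common ancestor. *)
Definition in_box (x : R) : Prop :=
  ditv R (- k%:Z, 0) x \/ ditv R (- k%:Z, -1) x.

Hypothesis f_supp : forall x, f x != 0 -> in_box x.

Lemma ditv_ge0 (I : dyadic) x : ditv R I x -> (0 <= x) = (0 <= I.2).
Proof. by move=> /in_ditv <-; rewrite floor_ge0 pmulr_rge0 ?exprz_gt0. Qed.

Lemma box_top x y : in_box x -> in_box y -> (0 <= x) = (0 <= y) ->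
  exists T, [/\ level T = - k%:Z, ditv R T x & ditv R T y].
Proof.
move=> [] hx [] hy; rewrite (ditv_ge0 hx) (ditv_ge0 hy) //= => _.
- by exists (- k%:Z, 0).
- by exists (- k%:Z, -1).
Qed.

Local Notation jump := (jump c n).
Local Notation mean := (mean mu f).
Local Notation S := (stopped (jumps mu c f n) k).
Local Notation c1 := (c1b mu).
Local Notation M := (c ^+ n).

(** The worst case is that of siblings: [M * c] comes from balance, and one [jump] from each of two
    passages to a stopping ancestor. *)
Definition dom_const : R := jump ^+ 2 * (M * c).

(* The first alternative gives a term of A_form, the second a term of C_form. *)
Definition dominated (C a : R) (x : R) : Prop :=
  (exists Q, [/\ S Q, ditv R Q x & a <= C * mean Q]) \/
  (exists IJ : dyadic * dyadic,
     [/\ S IJ.1, S IJ.2, ~ desc IJ.1 IJ.2 /\ ~ desc IJ.2 IJ.1,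
         dnear n IJ.1 IJ.2 /\ ~ dnear 2 IJ.1 IJ.2 &
      ditv R IJ.2 x /\
      a <= C * (Num.sqrt (mD mu IJ.1) * Num.sqrt (mD mu IJ.2) / mass mu IJ.2
                * mean IJ.1)]).

Lemma dominated_le C C' a b x : a <= C' * b -> 0 <= C' ->
  dominated C b x -> dominated (C' * C) a x.
Proof.
move=> ab C0 [[Q [SQ Qx h]]|[IJ [SI SJ d nn [Jx h]]]]; [left|right].
  by exists Q; split=> //; apply: le_trans ab _; rewrite -(mulrA C') ler_wpM2l.
by exists IJ; split=> //; split=> //; apply: le_trans ab _; rewrite -(mulrA C') ler_wpM2l.
Qed.

Let mass_gt0 I : 0 < mass mu I. Proof. exact: mass_gt0. Qed.
Let M_ge1 : 1 <= M. Proof. exact: exprn_ege1. Qed.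
Let A_ge1 : 1 <= jump. Proof. exact: jump_ge1. Qed.
Let M_ge0 : 0 <= M. Proof. exact: le_trans M_ge1. Qed.
Let A_ge0 : 0 <= jump. Proof. exact: le_trans A_ge1. Qed.
Let mean_ge0 I : 0 <= mean I. Proof. exact: mean_ge0. Qed.
Let c_ge0 : 0 <= c. Proof. exact: le_trans c_ge1. Qed.

Lemma dom_const_ge : [/\ M <= dom_const, jump * M <= dom_const,
  M * c <= dom_const & jump <= dom_const].
Proof.
rewrite /dom_const; move: jump A_ge1 A_ge0 M M_ge1 M_ge0 c_ge1 c_ge0.
move=> a a1 a0 m m1 m0 c1 c0.
have a2 : 1 <= a ^+ 2 by exact: exprn_ege1.
have aa : a <= a ^+ 2 by rewrite expr2 ler_peMl.
have mc : m <= m * c by rewrite ler_peMr.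
have am : a * m <= a ^+ 2 * (m * c) by apply: ler_pM.
split=> //.
- by apply: le_trans am; rewrite ler_peMl.
- by rewrite ler_peMl // mulr_ge0.
- by apply: le_trans am; rewrite ler_peMr.
Qed.

Let mean_dint I Q : dint mu f I <= dint mu f Q -> desc Q I -> mean I <= mean Q.
Proof.
move=> h d; rewrite /mean; apply: ler_pM => //; first exact: dint_ge0.
  by rewrite invr_ge0 ltW.
by rewrite lef_pV2 ?posrE // mass_le.
Qed.

Variable x : R.
Hypothesis x_box : in_box x.

Lemma box_top1 : exists T, level T = - k%:Z /\ ditv R T x.
Proof. by have [T [lT Tx _]] := box_top x_box x_box erefl; exists T. Qed.

Let T : dyadic := xget (0, 0) [set T | level T = - k%:Z /\ ditv R T x].
Let T_level : level T = - k%:Z.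
Proof.
rewrite /T; case: xgetP => [_ _ []|/(_ _)] //.
by have [T' h] := box_top1; move=> /(_ T') [].
Qed.
Let T_x : ditv R T x.
Proof.
rewrite /T; case: xgetP => [_ _ []|/(_ _)] //.
by have [T' h] := box_top1; move=> /(_ T') [].
Qed.

Let T_stopped : S T.
Proof. by split; rewrite ?T_level // stop_top. Qed.

(* An interval with a common ancestor with [T] lies on the same side of the
   origin, where [f] vanishes off [T]. *)
Let related_T I J y : ditv R J x -> dnear n I J -> ditv R I y -> f y != 0 ->
  ditv R T y.
Proof.
move=> Jx [s [t [_ e]]] Iy fy.
have Ky : ditv R (ancestor t J) y by rewrite -e; exact: ditv_ancestor Iy.
have Kx : ditv R (ancestor t J) x by exact: ditv_ancestor Jx.
have xy : (0 <= x) = (0 <= y) by rewrite (ditv_ge0 Kx) (ditv_ge0 Ky).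
have [T' [lT' T'x T'y]] := box_top x_box (f_supp fy) xy.
rewrite (_ : T = T') //; apply: ditv_meet_level T_x T'x _.
by rewrite T_level lT'.
Qed.

Let dint_related I J : ditv R J x -> dnear n I J -> dint mu f I <= dint mu f T.
Proof.
by move=> Jx IJ; apply: dint_le_supp => // y Iy; exact: related_T Jx IJ Iy.
Qed.

(** From the top level down, the failure of the first clause of [jumps] bounds the mean. Above it,
    [T] has no larger mass and no smaller integral of [f]. *)
Lemma mean_dominated Q : ditv R Q x ->
  exists Q', [/\ S Q', ditv R Q' x & mean Q <= jump * mean Q'].
Proof.
move=> Qx; case: (leP (- k%:Z) (level Q)) => lQ.
  exists (stop (jumps mu c f n) k Q); split; first exact: stopped_stop.
    exact: desc_sub (desc_stop _ lQ) _ Qx.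
  have [->|nj] := stopP (jumps mu c f n) lQ; first by rewrite ler_peMl.
  by rewrite leNgt; apply/negP => h; apply: nj; left.
exists T; split=> //; apply: (@le_trans _ _ (mean T)); last by rewrite ler_peMl.
apply: mean_dint; first exact: dint_related Qx (near_refl _ _).
by apply: meet_desc T_x Qx _; rewrite T_level ltW.
Qed.

(** With [J] already stopped, [I] is replaced by its stopping ancestor [I'], and the position of
    [I'] relative to [J] selects the alternative. *)
Lemma term_dominated_stopped I J : S J -> ditv R J x -> dnear n I J ->
  dominated dom_const (c1 I J * mean I) x.
Proof.
move=> SJ Jx nIJ; have [L1 L2 L3 L4] := dom_const_ge.
have avg_case C Q : S Q -> ditv R Q x -> C <= dom_const ->
    c1 I J * mean I <= C * mean Q -> dominated dom_const (c1 I J * mean I) x.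
  move=> SQ Qx CL h; left; exists Q; split=> //.
  by apply: le_trans h _; rewrite ler_wpM2r.
have c1M : c1 I J * mean I <= M * mean I by rewrite ler_wpM2r // c1b_le.
(* An interval [I] not inside [T] either contains [T], and has a smaller mean, or misses [T], and
   then [f] vanishes on it. *)
case: (pselect (desc I T)) => [IT|nIT]; last first.
  apply: (avg_case M T) => //; apply: le_trans c1M _; rewrite ler_wpM2l //.
  case: (pselect (desc T I)) => TI.
    by apply: mean_dint => //; exact: dint_related Jx nIJ.
  rewrite [leLHS](_ : _ = 0) // /mean dint_eq0 ?mul0r // => y Iy.
  apply/eqP/negPn/negP => fy; have Ty := related_T Jx nIJ Iy fy.
  by have [] := desc_total Iy Ty.
have lI : - k%:Z <= level I by rewrite -T_level; exact: desc_level.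
pose I' := stop (jumps mu c f n) k I.
have SI' : S I' by exact: stopped_stop.
have [r rI] : desc I I' by exact: desc_stop.
have mI : mean I <= jump * mean I'.
  have [<-|nj] := stopP (jumps mu c f n) lI; first by rewrite ler_peMl.
  by rewrite leNgt; apply/negP => h; apply: nj; left.
have JI'_case : desc J I' -> dominated dom_const (c1 I J * mean I) x.
  move=> d; apply: (avg_case (jump * M) I') => //; first exact: desc_sub Jx.
  by apply: le_trans c1M _; rewrite (mulrC jump) -(mulrA M) ler_wpM2l.
have [JI'|[rn nI'J]] := near_ancestor r nIJ; first by apply: JI'_case; rewrite -rI.
rewrite rI in nI'J.
case: (pselect (desc J I')) => [/JI'_case //|JI'].
(* If [I'] lies in [J], so does [I], and the term is bounded by the mean over [J]. *)
case: (pselect (desc I' J)) => I'J.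
  apply: (avg_case M J) => //.
  apply: le_trans (c1b_mean_le mu_fin c_ge1 mD_bal (dint_ge0 mu f_ge0 I) nIJ) _.
  rewrite ler_wpM2l // /mean ler_wpM2r ?invr_ge0 ?(ltW (mass_gt0 _)) //.
  apply: dint_le => //.
  by apply: desc_trans I'J; exists r.
have neIJ : (I == J) = false.
  by apply/eqP => h; apply: JI'; rewrite -h; exists r.
have mDI : mD mu I <= M * mD mu I'.
  by apply: mD_near => //; exists r, 0%N; rewrite addn0.
(* Disjoint and at distance above 2 gives a pair for [C_form]: both the mean and [mD] are moved from
   [I] to [I']. *)
case: (pselect (dnear 2 I' J)) => [n2|nn2]; last first.
  right; exists (I', J); split=> //; split=> //=.
  apply: (@le_trans _ _ (c1 I J * (jump * mean I'))).
    by rewrite ler_wpM2l // ltW // c1b_gt0.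
  have sI : Num.sqrt (mD mu I) <= M * Num.sqrt (mD mu I').
    have -> : M = Num.sqrt (M ^+ 2) by rewrite sqrtr_sqr ger0_norm.
    rewrite -(sqrtrM (mD mu I') (sqr_ge0 _)) ler_sqrt; last first.
      exact: mulr_ge0 (sqr_ge0 _) (ltW (mD_gt0 mu_fin I')).
    apply: le_trans mDI _; rewrite ler_pM2r ?mD_gt0 // expr2 ler_peMl //.
  rewrite (mulrA _ jump) (mulrA dom_const) ler_wpM2r //.
  apply: le_trans (_ : jump * M * _ <= _); last first.
    apply: ler_wpM2r L2; apply: mulr_ge0; last by rewrite invr_ge0 ltW.
    by apply: mulr_ge0; exact: sqrtr_ge0.
  rewrite /c1b neIJ (mulrC _ jump) -(mulrA jump) ler_wpM2l // (mulrA M).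
  rewrite ler_wpM2r ?invr_ge0 ?(ltW (mass_gt0 _)) //.
  by rewrite (sqrtrM (mD mu J) (ltW (mD_gt0 mu_fin I))) (mulrA M) ler_wpM2r ?sqrtr_ge0.
(* Siblings with parent [K]: by balance [mD mu J] is at most [c] times
   [mass mu I' * mass mu J / mass mu K], so the coefficient turns [mean I'] into an integral over
   [I'] divided by [mass mu K], at most [mean K] up to constants. *)
have e := near_siblings n2 I'J JI'; set K := parent J.
have mK : mD mu K = mass mu I' * mass mu J / mass mu K.
  by apply: mD_siblings e => h; apply: JI'; rewrite h; exact: desc_refl.
have Kx : ditv R K x by exact: ditv_parent.
have [K' [SK' K'x KK']] := mean_dominated Kx.
apply: (avg_case dom_const K') => //.
have I'K : dint mu f I' <= dint mu f K by apply: dint_le => //; exists 1%N.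
have mJ : mD mu J <= c * mD mu K by have /andP[] := mD_bal J.
have c1J : c1 I J <= M * c * (mass mu I' / mass mu K).
  rewrite /c1b neIJ ler_pdivrMr //.
  apply: le_trans (sqrt_mD_le mu_fin c_ge1 mD_bal nIJ) _.
  rewrite -mulrA -(mulrA M) ler_wpM2l //; apply: le_trans mJ _.
  by rewrite mK (mulrAC (mass mu I')) [leLHS]mulrA.
apply: (@le_trans _ _ (M * c * (mass mu I' / mass mu K) * (jump * mean I'))).
  by apply: ler_pM => //; rewrite ltW // c1b_gt0.
have -> : M * c * (mass mu I' / mass mu K) * (jump * mean I') =
    M * c * jump * (dint mu f I' / mass mu K).
  rewrite -(mean_mass mu_fin f I').
  by move: M jump (mean I') (mass mu I') (mass mu K)^-1 => ? ? ? ? ?; ring.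
apply: (@le_trans _ _ (M * c * jump * (jump * mean K'))).
  rewrite ler_wpM2l ?mulr_ge0 //; apply: le_trans KK'.
  by rewrite ler_wpM2r // invr_ge0 ltW.
rewrite le_eqVlt; apply/orP; left; apply/eqP; rewrite /dom_const.
by move: M jump (mean K') => ? ? ?; ring.
Qed.

Lemma term_dominated I J : ditv R J x -> dnear n I J ->
  dominated (jump * dom_const) (c1 I J * mean I) x.
Proof.
move=> Jx nIJ; have [L1 L2 L3 L4] := dom_const_ge.
have L0 : 0 <= dom_const by exact: le_trans L1.
case: (leP (- k%:Z) (level J)) => lJ; last first.
  left; exists T; split=> //.
  apply: (@le_trans _ _ (dom_const * mean T)); last first.
    by rewrite ler_wpM2r // ler_peMl.
  apply: (@le_trans _ _ (M * mean T)); last by rewrite ler_wpM2r.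
  apply: le_trans (c1b_mean_le mu_fin c_ge1 mD_bal (dint_ge0 mu f_ge0 I) nIJ) _.
  rewrite ler_wpM2l //; apply: ler_pM => //; first exact: dint_ge0.
  - by rewrite invr_ge0 ltW.
  - exact: dint_related Jx nIJ.
  - rewrite lef_pV2 ?posrE // mass_le //; apply: meet_desc T_x Jx _.
    by rewrite T_level ltW.
pose J' := stop (jumps mu c f n) k J.
have SJ' : S J' by exact: stopped_stop.
have J'x : ditv R J' x by exact: desc_sub (desc_stop _ lJ) _ Jx.
(* If [J] is not stopped, the second clause of [jumps] fails from [J'] to [J]; its negation supplies
   an [I'] whose term at [J'] is comparable. *)
have [I' nI'J' h] : exists2 I', dnear n I' J' &
    c1 I J * mean I <= jump * (c1 I' J' * mean I').
  have [e|nj] := stopP (jumps mu c f n) lJ.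
    by exists I; rewrite /J' e // ler_peMl // mulr_ge0 // ltW // c1b_gt0.
  apply: contrapT => no; apply: nj; right; exists I => // I' nI'J'.
  by rewrite ltNge; apply/negP => h; apply: no; exists I'.
by apply: dominated_le h _ _ => //; exact: term_dominated_stopped.
Qed.

End pointwise.

(** * Supports of test functions and integrals of weighted indicators *)

Section support.
Context (R : realType) (mu : {measure set (measurableTypeR R) -> \bar R}).

Lemma in_box_of_norm (k : nat) (x : R) : `|x| <= k%:R -> in_box k x.
Proof.
(* From [k < 2 ^ k]; strictness is needed at the excluded right endpoint. *)
move=> xk; have lt : `|x| < 2 ^+ k.
  by apply: le_lt_trans xk _; rewrite -natrX ltr_nat ltn_expl.
have p0 : 0 < (2 : R) ^+ k by rewrite exprn_gt0.
move: lt; rewrite ltr_norml => /andP[lo hi].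
have e : (2 : R) ^ (- k%:Z) * x = x / 2 ^+ k.
  by rewrite -invr_expz mulrC.
have [x0|x0] := leP 0 x; [left|right]; apply/in_ditv; rewrite e; apply: floor_def.
  by rewrite add0r divr_ge0 ?(ltW p0) // ltr_pdivrMr // mul1r.
by rewrite addNr ltr_pdivrMr // mul0r x0 ler_pdivlMr // mulN1r ltW.
Qed.

Lemma test_fun_support (f : R -> R) : test_fun mu f ->
  exists r : R, forall x, f x != 0 -> `|x| <= r.
Proof.
move=> [_ /compact_bounded [r [_ h]] _ _].
exists (r + 1) => x fx; apply: (h (r + 1)); first by rewrite ltrDl.
exact: subset_closure.
Qed.

End support.

Section integrals.
Context (R : realType) (mu : {measure set (measurableTypeR R) -> \bar R}).
Variable f : R -> R.
Hypothesis f_int : mu.-integrable [set: measurableTypeR R] (EFin \o f).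
Hypothesis f_ge0 : forall x, 0 <= f x.

Lemma measurable_scaled_indic (a : R) (Q : dyadic) :
  measurable_fun [set: measurableTypeR R]
    (fun x => (a * \1_(ditv R Q) x * f x)%:E).
Proof.
apply/measurable_EFinP; apply: measurable_funM; last first.
  by apply/measurable_EFinP; case/integrableP: f_int.
apply: measurable_funM => //; apply: measurable_indic; exact: measurable_ditv.
Qed.

Lemma integral_scaled_indic (a : R) (Q : dyadic) : 0 <= a ->
  (\int[mu]_x (a * \1_(ditv R Q) x * f x)%:E = (a * dint mu f Q)%:E)%E.
Proof.
move=> a0; under eq_integral do rewrite -mulrA EFinM.
rewrite ge0_integralZl_EFin //.
- rewrite EFinM -dintE // [in RHS]integral_mkcond; congr (_ * _)%E.
  apply: eq_integral => x _; rewrite patchE indicE.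
  by case: ifP => _; rewrite ?mul1r ?mul0r.
- by move=> x _; rewrite lee_fin mulr_ge0.
- have := measurable_scaled_indic 1 Q; congr measurable_fun.
  by apply/funext => x; rewrite mul1r.
Qed.

End integrals.

(** * Integration of the pointwise bound *)

Theorem theorem2p9 (R : realType)
    (mu : {measure set (measurableTypeR R) -> \bar R}) (N : nat)
    (mu_fin : forall I : dyadic, (0 < mu (ditv R I) < +oo)%E)
    (mu_bal : balanced mu) :
  exists eta C : R,
    [/\ 0 < eta < 1, 0 < C &
      forall f1 f2 : R -> R, test_fun mu f1 -> test_fun mu f2 ->
        exists S : set dyadic, sparse_family mu eta S /\
          (`| pairing mu (maximalN mu N f1) (EFin \o f2) |
             <= C%:E * (A_form mu S f1 f2 + C_form mu N S f1 f2))%E].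
Proof.
have [_ [c [c1 bal]]] := mu_bal.
pose n := (N + 2)%N.
pose C := jump c n * dom_const c n.
have C0 : 0 < C.
  have [L _ _ _] := dom_const_ge c1 n.
  rewrite mulr_gt0 ?jump_gt0 //; apply: lt_le_trans L; apply: lt_le_trans ltr01 _.
  exact: exprn_ege1.
exists 2^-1, C; split=> //; first by apply/andP; split; lra.
move=> f1 f2 t1 t2.
have [i1 _ _ p1] := t1; have [i2 _ _ p2] := t2.
have [r1 h1] := test_fun_support t1; have [r2 h2] := test_fun_support t2.
(* One box for both supports: that of [f1] for the stopping argument, that of [f2] to place every
   relevant [x] in the box. *)
have [k [hk1 hk2]] : exists k : nat, r1 <= k%:R /\ r2 <= k%:R.
  exists (Num.trunc (Num.max r1 r2)).+1.
  have := ltW (truncnS_gt (Num.max r1 r2)).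
  by rewrite ge_max => /andP[].
have s1 x : f1 x != 0 -> in_box k x.
  by move=> /h1 h; apply: in_box_of_norm; exact: le_trans hk1.
have s2 x : f2 x != 0 -> in_box k x.
  by move=> /h2 h; apply: in_box_of_norm; exact: le_trans hk2.
pose S := stopped (jumps mu c f1 n) k.
exists S; split.
  apply: stopped_sparse => // J; exact: mu_jumps_le.
pose P : set (dyadic * dyadic) := [set JK : dyadic * dyadic |
       [/\ S JK.1, S JK.2, ditv R JK.1 `&` ditv R JK.2 = set0
         & (2%:E < ddist R JK.1 JK.2 <= ((N + 2)%N%:R)%:E)%E]].
have m0 I : 0 < mass mu I by exact: mass_gt0.
pose a Q : R := mean mu f1 Q.
have a0 Q : 0 <= a Q by exact: mean_ge0.
pose b (IJ : dyadic * dyadic) : R :=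
  Num.sqrt (mD mu IJ.1) * Num.sqrt (mD mu IJ.2) / mass mu IJ.2 * a IJ.1.
have b0 IJ : 0 <= b IJ.
  by rewrite mulr_ge0 // mulr_ge0 ?invr_ge0 ?(ltW (m0 _)) // mulr_ge0 ?sqrtr_ge0.
(* [F] and [G] are the pointwise majorants; integrating them term by term gives [A_form] and
   [C_form]. *)
pose F x : \bar R := (\esum_(Q in S) (a Q * \1_(ditv R Q) x * f2 x)%:E)%E.
pose G x : \bar R := (\esum_(IJ in P) (b IJ * \1_(ditv R IJ.2) x * f2 x)%:E)%E.
have Ft0 Q x : (0 <= (a Q * \1_(ditv R Q) x * f2 x)%:E)%E.
  rewrite lee_fin indicE.
  exact: mulr_ge0 (mulr_ge0 (a0 _) (ler0n _ _)) (p2 _).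
have Gt0 IJ x : (0 <= (b IJ * \1_(ditv R IJ.2) x * f2 x)%:E)%E.
  rewrite lee_fin indicE.
  exact: mulr_ge0 (mulr_ge0 (b0 _) (ler0n _ _)) (p2 _).
have F0 x : (0 <= F x)%E by apply: esum_ge0.
have G0 x : (0 <= G x)%E by apply: esum_ge0.
have avg0 I : (0 <= avg mu (fun y => `|f1 y|%R) I)%E.
  rewrite mule_ge0 ?lee_fin ?invr_ge0 ?(ltW (m0 _)) //.
  by apply: integral_ge0 => y _; rewrite lee_fin.
have M0 x : (0 <= maximalN mu N f1 x)%E.
  have : [set IJ : dyadic * dyadic |
      (ddist R IJ.1 IJ.2 <= ((N + 2)%N%:R)%:E)%E] ((0, 0), (0, 0)).
    exact/ddist_near/near_refl.
  move=> /(imageP (fun IJ : dyadic * dyadic => ((c1b mu IJ.1 IJ.2)%:E *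
    avg mu (fun y => `|f1 y|%R) IJ.1 * (\1_(ditv R IJ.2) x)%:E)%E)).
  move=> /ereal_sup_ubound; apply: le_trans.
  apply: mule_ge0; last by rewrite lee_fin indicE.
  by apply: mule_ge0 => //; rewrite lee_fin ltW // c1b_gt0.
have pointwise x : (maximalN mu N f1 x * (f2 x)%:E <= C%:E * (F x + G x))%E.
  have [->|f2x] := eqVneq (f2 x) 0.
    by rewrite mule0 mule_ge0 // ?adde_ge0 // lee_fin ltW.
  (* Dividing by [f2 x > 0] reduces the claim to one element of the supremum at a time, and each is
     dominated by a single term of [F] or [G]. *)
  have f2x0 : 0 < f2 x by rewrite lt_neqAle eq_sym f2x p2.
  rewrite muleC -lee_pdivlMl //; apply: ge_ereal_sup => _ [[I J] /= nIJ <-].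
  rewrite lee_pdivlMl //.
  rewrite (_ : (fun y => `|f1 y|) = f1); last first.
    by apply/funext => y; rewrite ger0_norm.
  rewrite avgE // -!EFinM indicE; case: (boolP (x \in _)) => [|_]; last first.
    by rewrite !mulr0 mule_ge0 // ?adde_ge0 // lee_fin ltW.
  rewrite inE => Jx; rewrite mulr1.
  have /ddist_near nIJ' := nIJ.
  have [[Q [SQ Qx h]]|[[I1 J1] /= [SI SJ [d d'] [nn n2] [J1x h]]]] :=
      term_dominated mu_fin c1 bal i1 p1 s1 (s2 _ f2x) Jx nIJ'.
    apply: (@le_trans _ _ (C%:E * (a Q * \1_(ditv R Q) x * f2 x)%:E)%E).
      rewrite -EFinM lee_fin indicE mem_set // mulr1.
      by rewrite (mulrA C) [leRHS]mulrC; apply: ler_wpM2l.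
    apply: lee_wpmul2l; first by rewrite lee_fin ltW.
    apply: le_trans (leeDl _ (G0 x)); apply: esum_ge.
    by exists [set Q]; [split=> // _ ->|rewrite fsbig_set1].
  apply: (@le_trans _ _ (C%:E * (b (I1, J1) * \1_(ditv R J1) x * f2 x)%:E)%E).
    rewrite -EFinM lee_fin indicE mem_set // mulr1.
      by rewrite (mulrA C) [leRHS]mulrC; apply: ler_wpM2l.
  apply: lee_wpmul2l; first by rewrite lee_fin ltW.
  apply: le_trans (leeDr _ (F0 x)); apply: esum_ge.
  exists [set (I1, J1)]; last by rewrite fsbig_set1.
  split=> // _ -> /=; split=> //.
    rewrite -subset0 => y [y1 y2].
    by have [] := desc_total y1 y2.
  apply/andP; split; last exact/ddist_near.
  by rewrite ltNge; apply/negP => /ddist_near.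
rewrite gee0_abs; last by apply: integral_ge0 => x _; rewrite mule_ge0 //= lee_fin.
have mF : measurable_fun [set: measurableTypeR R] F.
  apply: measurable_esum => [Q x _|Q _]; first exact: Ft0.
  exact: measurable_scaled_indic i2 _ _.
have mG : measurable_fun [set: measurableTypeR R] G.
  apply: measurable_esum => [IJ x _|IJ _]; first exact: Gt0.
  exact: measurable_scaled_indic i2 _ _.
apply: le_trans (ge0_integral_mono mu _ pointwise) _.
  by move=> x; rewrite mule_ge0 // lee_fin.
rewrite ge0_integralZl_EFin //; last 3 first.
- by move=> x _; rewrite adde_ge0.
- exact: emeasurable_funD.
- exact: ltW.
apply: lee_wpmul2l; first by rewrite lee_fin ltW.
rewrite ge0_integralD //; apply: leeD.
- rewrite integral_esum => [|Q x _|Q _]; last 2 first.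
  + exact: Ft0.
  + exact: measurable_scaled_indic i2 _ _.
  apply: le_esum => Q _; rewrite integral_scaled_indic // !avgE // mu_ditv //.
  by rewrite -!EFinM lee_fin -mulrA divfK // gt_eqF.
- rewrite integral_esum => [|IJ x _|IJ _]; last 2 first.
  + exact: Gt0.
  + exact: measurable_scaled_indic i2 _ _.
  apply: le_esum => IJ _; rewrite integral_scaled_indic // !avgE //.
  rewrite -!EFinM lee_fin /b /a /mean le_eqVlt; apply/orP; left; apply/eqP.
  move: (Num.sqrt _) (Num.sqrt _) (dint _ _ _) (dint _ _ _) (mass _ _)^-1.
  by move: (mass _ _)^-1 => ? ? ? ? ? ?; ring.
Qed.
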